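(* Let $f:\mathbb{R}^n\times\mathbb{R}^n\to\mathbb{R}$ be a bifunction such that 1. $f$ vanishes on the diagonal of $\mathbb{R}^n\times\mathbb{R}^n$, and 2. $f(\cdot,y)$ is quasiconvex for all $y\in\mathbb{R}^n$. If $f$ has the upper sign property on $\mathbb{R}^n$, then $-f$ is pseudomonotone.
   Context: A bifunction $g:\mathbb{R}^n\times\mathbb{R}^n\to\mathbb{R}$ is pseudomonotone if for all $x,y\in\mathbb{R}^n$, $g(x,y)\ge0\Rightarrow g(y,x)\le0$. $f$ has the upper sign property on $\mathbb{R}^n$ if for all $x,y\in\mathbb{R}^n$, with $x_t=(1-t)x+ty$: ($f(x_t,x)\le0$ for all $t\in]0,1[$) implies $f(x,y)\ge0$. A function $h:\mathbb{R}^n\to\mathbb{R}$ is quasiconvex if $h((1-t)x+ty)\le\max\{h(x),h(y)\}$ for all $x,y\in\mathbb{R}^n$ and $t\in[0,1]$. *)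

(* Defs.v *)
From mathcomp Require Import all_boot all_order all_algebra.
From mathcomp Require Import reals.

Set Implicit Arguments.
Unset Strict Implicit.
Unset Printing Implicit Defensive.

Import Order.TTheory GRing.Theory Num.Theory.
Local Open Scope ring_scope.

Section Bifunctions.
Context {R : realType} {n : nat}.
Implicit Types (f g : 'rV[R]_n -> 'rV[R]_n -> R) (h : 'rV[R]_n -> R).

Definition pseudomonotone g : Prop :=
  forall x y, 0 <= g x y -> g y x <= 0.

Definition upper_sign_property f : Prop :=
  forall x y,
    (forall t : R, 0 < t < 1 -> f ((1 - t) *: x + t *: y) x <= 0) ->
    0 <= f x y.

Definition quasiconvex h : Prop :=
  forall x y (t : R), 0 <= t <= 1 ->
    h ((1 - t) *: x + t *: y) <= Num.max (h x) (h y).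

End Bifunctions.

(* Main.v *)
Require Import Defs.
From mathcomp Require Import all_boot all_order all_algebra.
From mathcomp Require Import reals.

Import Order.TTheory GRing.Theory Num.Theory.
Local Open Scope ring_scope.

Theorem proposition3p3 (R : realType) (n : nat)
    (f : 'rV[R]_n -> 'rV[R]_n -> R)
    (f_diag : forall x : 'rV[R]_n, f x x = 0)
    (f_qcvx : forall y : 'rV[R]_n, quasiconvex (fun x => f x y))
    (f_usp : upper_sign_property f) :
  pseudomonotone (fun x y => - f x y).
Proof.
move=> x y; rewrite oppr_ge0 oppr_le0 => fxy_le0.
(* The upper sign property is used from [y] towards [x], so that its premise concerns only [f _ y],
   the function whose sign at [x] is given by [fxy_le0]. *)
apply: f_usp => t /andP[t_gt0 t_lt1].
have t01 : 0 <= t <= 1 by rewrite !ltW.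
(* Sublevel sets of [f _ y] are convex, so nonpositivity at both endpoints spreads to the whole
   segment: the value at [y] is 0 by [f_diag], and the value at [x] is at most 0 by [fxy_le0]. *)
by rewrite (le_trans (f_qcvx y y x t t01))// ge_max f_diag lexx.
Qed.
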